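(* Let $\beta,\gamma\in[0,2)$ with $\beta+\gamma<2$, and for $n\ge 0$ and $x\in[-1,1]$ let $$T_n^{\beta,\gamma}(x)=\cos\left(\frac{2n}{2-\beta-\gamma}\left(\arccos x-\frac{\gamma\pi}{2}\right)\right).$$ Then for all $u$ with $|u|<1$ and all $x\in[-1,1]$, the ordinary generating function $F^{\beta,\gamma}(u,x)=\sum_{n=0}^\infty T_n^{\beta,\gamma}(x)\,u^n$ satisfies $$F^{\beta,\gamma}(u,x)=\frac{1-u\,T_1^{\beta,\gamma}(x)}{1+u^2-2u\,T_1^{\beta,\gamma}(x)}.$$
   Context: Here $u$ is real. The functions $T_n^{\beta,\gamma}$ are called the $(\beta,\gamma)$-Chebyshev functions of the first kind on $[-1,1]$. *)

(* Defs.v *)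
From Stdlib Require Import Reals.
From Coquelicot Require Import Coquelicot.
Open Scope R_scope.

Definition chebT (beta gamma : R) (n : nat) (x : R) : R :=
  cos (2 * INR n / (2 - beta - gamma) * (acos x - gamma * PI / 2)).

(* [PSeries] is total, so convergence has to be asserted separately, by
   [ex_pseries]. *)
Definition chebT_genfun (beta gamma u x : R) : R :=
  PSeries (fun n => chebT beta gamma n x) u.

(* Main.v *)
Require Import Defs.
From Stdlib Require Import Reals Lra.
From Coquelicot Require Import Coquelicot.
Open Scope R_scope.

(** With [t = 2 / (2 - beta - gamma) * (acos x - gamma * PI / 2)] one has
    [chebT beta gamma n x = cos (n t)], so the theorem is the classical summation
    of [cos (n t) * u ^ n].  Multiplying by [D = 1 + u ^ 2 - 2 u cos t] makes the
    partial sums telescope, because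
    [cos ((n + 2) t) + cos (n t) = 2 cos t cos ((n + 1) t)]
    ([sum_cos_geom]).  The two boundary terms left over are powers of [u] times
    cosines, hence tend to 0 ([is_lim_seq_geom_cos]), and [D] is positive
    ([cos_kernel_pos]), so one may divide by it in the limit. *)

Lemma cos_kernel_pos (u t : R) :
  Rabs u < 1 -> 0 < 1 + u ^ 2 - 2 * u * cos t.
Proof.
intros Hu; apply Rabs_def2 in Hu.
destruct (COS_bound t) as [Hl Hr].
(* affine in [cos t], with values [(1 + u)^2] and [(1 - u)^2] at the ends *)
replace (1 + u ^ 2 - 2 * u * cos t)
  with ((1 - cos t) / 2 * (1 + u) ^ 2 + (1 + cos t) / 2 * (1 - u) ^ 2) by field.
assert (0 < (1 + u) ^ 2) by (apply pow_lt; lra).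
assert (0 < (1 - u) ^ 2) by (apply pow_lt; lra).
destruct (Rle_lt_dec (cos t) 0).
- apply Rplus_lt_le_0_compat;
    [apply Rmult_lt_0_compat | apply Rmult_le_pos]; lra.
- apply Rplus_le_lt_0_compat;
    [apply Rmult_le_pos | apply Rmult_lt_0_compat]; lra.
Qed.

Lemma cos_INR_rec (n : nat) (t : R) :
  cos (INR (S (S n)) * t) + cos (INR n * t) = 2 * cos t * cos (INR (S n) * t).
Proof.
replace (INR (S (S n)) * t) with (INR (S n) * t + t) by (rewrite !S_INR; ring).
replace (INR n * t) with (INR (S n) * t - t) by (rewrite S_INR; ring).
rewrite cos_plus, cos_minus; ring.
Qed.

Lemma sum_cos_geom (u t : R) (n : nat) :
  (1 + u ^ 2 - 2 * u * cos t) * sum_n (fun k => cos (INR k * t) * u ^ k) n =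
  1 - u * cos t - u ^ S n * cos (INR (S n) * t) + u ^ S (S n) * cos (INR n * t).
Proof.
induction n as [|n IH].
- rewrite sum_O; simpl; rewrite Rmult_0_l, Rmult_1_l, cos_0; ring.
- rewrite sum_Sn; change plus with Rplus.
  rewrite Rmult_plus_distr_l, IH.
  replace (cos (INR (S (S n)) * t))
    with (2 * cos t * cos (INR (S n) * t) - cos (INR n * t))
    by (rewrite <- cos_INR_rec; ring).
  simpl pow; ring.
Qed.

Lemma is_lim_seq_geom_cos (u : R) (f : nat -> R) :
  Rabs u < 1 -> is_lim_seq (fun n => u ^ n * cos (f n)) 0.
Proof.
intros Hu.
apply is_lim_seq_abs_0.
apply is_lim_seq_le_le with (u := fun _ => 0) (w := fun n => Rabs u ^ n).
- intros n; split; [apply Rabs_pos|].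
  rewrite Rabs_mult, <- RPow_abs.
  apply Rle_trans with (Rabs u ^ n * 1); [|lra].
  apply Rmult_le_compat_l; [apply pow_le, Rabs_pos|].
  apply Rabs_le, COS_bound.
- apply is_lim_seq_const.
- apply is_lim_seq_geom; rewrite Rabs_Rabsolu; exact Hu.
Qed.

Lemma is_pseries_cos (u t : R) :
  Rabs u < 1 ->
  is_pseries (fun n => cos (INR n * t)) u
    ((1 - u * cos t) / (1 + u ^ 2 - 2 * u * cos t)).
Proof.
intros Hu.
pose proof (cos_kernel_pos u t Hu) as HD.
apply is_pseries_R.
set (D := 1 + u ^ 2 - 2 * u * cos t) in *.
change (is_lim_seq (sum_n (fun n => cos (INR n * t) * u ^ n))
          (Finite ((1 - u * cos t) / D))).
apply is_lim_seq_ext with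
  (u := fun n => / D * ((1 - u * cos t) - u * (u ^ n * cos (INR (S n) * t))
                        + u ^ 2 * (u ^ n * cos (INR n * t)))).
- intros n.
  apply (Rmult_eq_reg_l D); [|lra].
  unfold D at 3; rewrite sum_cos_geom.
  simpl pow; field; lra.
- replace ((1 - u * cos t) / D)
    with (/ D * ((1 - u * cos t) - u * 0 + u ^ 2 * 0)) by (field; lra).
  apply (is_lim_seq_scal_l _ (/ D) (Finite _)).
  apply is_lim_seq_plus'; [apply is_lim_seq_minus'|].
  + apply is_lim_seq_const.
  + apply (is_lim_seq_scal_l _ u (Finite 0)).
    exact (is_lim_seq_geom_cos u (fun n => INR (S n) * t) Hu).
  + apply (is_lim_seq_scal_l _ (u ^ 2) (Finite 0)).
    exact (is_lim_seq_geom_cos u (fun n => INR n * t) Hu).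
Qed.

Theorem mainTheorem4 (beta gamma : R)
  (hbeta : 0 <= beta < 2) (hgamma : 0 <= gamma < 2) (hsum : beta + gamma < 2)
  (u : R) (hu : Rabs u < 1) (x : R) (hx : -1 <= x <= 1) :
  ex_pseries (fun n : nat => chebT beta gamma n x) u /\
  chebT_genfun beta gamma u x =
    (1 - u * chebT beta gamma 1 x) / (1 + u ^ 2 - 2 * u * chebT beta gamma 1 x).
Proof.
set (t := 2 / (2 - beta - gamma) * (acos x - gamma * PI / 2)).
assert (HT : forall n, cos (INR n * t) = chebT beta gamma n x).
{ intros n; unfold chebT, t; f_equal; field; lra. }
assert (H : is_pseries (fun n => chebT beta gamma n x) u
  ((1 - u * chebT beta gamma 1 x) / (1 + u ^ 2 - 2 * u * chebT beta gamma 1 x))).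
{ apply is_pseries_ext with (a := fun n => cos (INR n * t)); [exact HT|].
  rewrite <- HT; simpl INR; rewrite Rmult_1_l.
  apply is_pseries_cos, hu. }
split.
- eexists; exact H.
- exact (is_pseries_unique _ _ _ H).
Qed.
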